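(* Let $A,B,C,D,E,F\in\mathbb{R}$ with $A\neq 0$, $B\neq 0$, $C\neq 0$, and consider the conic $$\mathcal{K}=\{(x,y)\in\mathbb{R}^2 : Ax^2+2Bxy+Cy^2+2Dx+2Ey+F=0\}.$$ Suppose that the vectors $\binom{A}{B},\binom{B}{C}$ are linearly dependent, i.e. $\delta=AC-B^2=0$, and that $\binom{-D}{-E}$ belongs to the span of $\binom{A}{B}$, which equals the span of $\binom{B}{C}$ (so that $BD-AE=0$ and $CD-BE=0$). Then the conic has infinitely many centers, and $$\Delta=\begin{vmatrix} A & B & D \\ B & C & E \\ D & E & F \end{vmatrix}=0.$$ Moreover, with $M_{22}=AF-D^2$ and $M_{11}=CF-E^2$: (1) if $M_{22}<0$, then $\mathcal{K}$ consists of two parallel lines; if $M_{22}>0$, then $\mathcal{K}=\emptyset$; if $M_{22}=0$, then $\mathcal{K}$ is a line. (2) if $M_{11}<0$, then $\mathcal{K}$ consists of two parallel lines; if $M_{11}>0$, then $\mathcal{K}=\emptyset$; if $M_{11}=0$, then $\mathcal{K}$ is a line.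
   Context: A center of the conic is a point $(h,k)\in\mathbb{R}^2$ that solves the linear system $Ah+Bk=-D$, $Bh+Ck=-E$. The two parallel lines are distinct. The quantities $M_{11}$ and $M_{22}$ are the principal minors of order two of the matrix $\begin{pmatrix} A & B & D \\ B & C & E \\ D & E & F \end{pmatrix}$ obtained by deleting the first row and column, respectively the second row and column. *)

(* Defs.v *)
(* The real line is an abstract [R : realType]; the plane R^2 is ['cV[R]_2]. *)
From mathcomp Require Import all_boot all_order all_algebra.
From mathcomp Require Import classical_sets cardinality reals.

Set Implicit Arguments.
Unset Strict Implicit.
Unset Printing Implicit Defensive.

Import Order.TTheory GRing.Theory Num.Theory.

Local Open Scope classical_set_scope.
Local Open Scope ring_scope.

Definition vec2 (R : realType) (x y : R) : 'cV[R]_2 :=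
  \col_(i < 2) [:: x; y]`_i.

Definition conic (R : realType) (A B C D E F : R) : set 'cV[R]_2 :=
  [set p | let x := p 0 0 in let y := p 1 0 in
     A * x ^+ 2 + 2 * B * x * y + C * y ^+ 2 + 2 * D * x + 2 * E * y + F = 0].

Definition conic_mx (R : realType) (A B C D E F : R) : 'M[R]_3 :=
  \matrix_(i < 3, j < 3)
    (nth [::] [:: [:: A; B; D]; [:: B; C; E]; [:: D; E; F]] i)`_j.

(* Indices start at 0, so the minors usually written M_11 and M_22 are
   [principal_minor M 0] and [principal_minor M 1]. *)
Definition principal_minor (R : realType) (M : 'M[R]_3) (i : 'I_3) : R :=
  \det (row' i (col' i M)).

Definition centers (R : realType) (A B C D E : R) : set 'cV[R]_2 :=
  [set p | let h := p 0 0 in let k := p 1 0 in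
     A * h + B * k = - D /\ B * h + C * k = - E].

(* A genuine line only when the direction [u] is nonzero. *)
Definition line (R : realType) (p u : 'cV[R]_2) : set 'cV[R]_2 :=
  [set p + t *: u | t in [set: R]].

Definition is_line (R : realType) (L : set 'cV[R]_2) : Prop :=
  exists p u : 'cV[R]_2, u != 0 /\ L = line p u.

(* Having a common direction; a line is parallel to itself in this sense, hence
   the separate distinctness condition in [is_two_parallel_lines]. *)
Definition parallel (R : realType) (L1 L2 : set 'cV[R]_2) : Prop :=
  exists p1 p2 u : 'cV[R]_2, [/\ u != 0, L1 = line p1 u & L2 = line p2 u].

Definition is_two_parallel_lines (R : realType) (K : set 'cV[R]_2) : Prop :=
  exists L1 L2 : set 'cV[R]_2,
    [/\ is_line L1, is_line L2, parallel L1 L2, L1 <> L2 & K = L1 `|` L2].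

(* Main.v *)
Require Import Defs.
From mathcomp Require Import all_boot all_order all_algebra.
From mathcomp Require Import classical_sets cardinality reals.
From mathcomp Require Import ring lra.

Set Implicit Arguments.
Unset Strict Implicit.
Unset Printing Implicit Defensive.

Import Order.TTheory GRing.Theory Num.Theory.

Local Open Scope classical_set_scope.
Local Open Scope ring_scope.

(* Since A C = B^2 and A E = B D, multiplying the equation of the conic by A
   completes the square: it becomes (A x + B y + D)^2 = - M22.  The level sets
   of A x + B y + D are parallel lines, and A^2 M11 = B^2 M22 makes the two minors
   have the same sign. *)

Lemma vec2E0 (R : realType) (x y : R) : vec2 x y 0 0 = x.
Proof. by rewrite mxE. Qed.

Lemma vec2E1 (R : realType) (x y : R) : vec2 x y 1 0 = y.
Proof. by rewrite mxE. Qed.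

Lemma cV2P (T : Type) (u v : 'cV[T]_2) :
  u = v <-> u 0 0 = v 0 0 /\ u 1 0 = v 1 0.
Proof.
split=> [-> // | [e0 e1]]; apply/matrixP => i j; rewrite (ord1 j).
case: i => -[|[|//]] lti.
- by have -> : Ordinal lti = 0 by apply/val_inj.
- by have -> : Ordinal lti = 1 by apply/val_inj.
Qed.

Lemma vec2_eq0 (R : realType) (x y : R) :
  (vec2 x y == 0) = (x == 0) && (y == 0).
Proof.
apply/eqP/andP => [/cV2P|[/eqP x0 /eqP y0]].
  by rewrite vec2E0 vec2E1 !mxE => -[-> ->].
by apply/cV2P; rewrite vec2E0 vec2E1 !mxE.
Qed.

Lemma det_mx22 (R : comNzRingType) (M : 'M[R]_2) :
  \det M = M 0 0 * M 1 1 - M 0 1 * M 1 0.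
Proof.
rewrite (expand_det_row _ 0) !big_ord_recl big_ord0 /cofactor !det_mx11 !mxE /=.
have -> : lift 0 0 = 1 :> 'I_2 by apply/val_inj.
have -> : lift 1 0 = 0 :> 'I_2 by apply/val_inj.
by rewrite /= /bump /=; ring.
Qed.

Lemma det_mx33 (R : comNzRingType) (M : 'M[R]_3) :
  \det M = M 0 0 * (M 1 1 * M 2 2 - M 1 2 * M 2 1)
         - M 0 1 * (M 1 0 * M 2 2 - M 1 2 * M 2 0)
         + M 0 2 * (M 1 0 * M 2 1 - M 1 1 * M 2 0).
Proof.
rewrite (expand_det_row _ 0) !big_ord_recl big_ord0 /cofactor !det_mx22 !mxE /=.
have l00 : lift 0 0 = 1 :> 'I_3 by apply/val_inj.
have l01 : lift 0 1 = 2 :> 'I_3 by apply/val_inj.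
have l10 : lift 1 0 = 0 :> 'I_3 by apply/val_inj.
have l11 : lift 1 1 = 2 :> 'I_3 by apply/val_inj.
have l20 : lift 2 0 = 0 :> 'I_3 by apply/val_inj.
have l21 : lift 2 1 = 1 :> 'I_3 by apply/val_inj.
have l0' : lift 0 (lift 0 0) = 2 :> 'I_3 by apply/val_inj.
rewrite ?(l0', l00, l01, l10, l11, l20, l21).
by rewrite /= /bump /=; ring.
Qed.

(** The points [p + n%:R *: u] for natural [n] are pairwise distinct because [u] is nonzero, so a
    finite line would pull back to a finite set of all naturals. *)
Lemma infinite_line (R : realType) (p u : 'cV[R]_2) :
  u != 0 -> infinite_set (line p u).
Proof.
move=> u0 fin; apply: infinite_nat.
pose f (n : nat) := p + n%:R *: u.
have f_inj : injective f.
  move=> m n /addrI /eqP; rewrite -subr_eq0 -scalerBl scaler_eq0.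
  by rewrite (negPf u0) orbF subr_eq0 eqr_nat => /eqP.
have <- : f @^-1` line p u = [set: nat].
  by apply/seteqP; split=> n // _; exists n%:R.
by apply: finite_preimage fin => m n _ _; apply: f_inj.
Qed.

Definition level_set (R : realType) (A B c : R) : set 'cV[R]_2 :=
  [set p | A * p 0 0 + B * p 1 0 = c].

(** The direction [vec2 (- B) A] is orthogonal to the normal [vec2 A B], and the base point is where
    the level set meets the axis y = 0. The parameter of a point is therefore its second coordinate
    divided by [A]. *)
Lemma level_set_line (R : realType) (A B c : R) : A != 0 ->
  level_set A B c = line (vec2 (c / A) 0) (vec2 (- B) A).
Proof.
move=> A0; apply/seteqP; split=> p; rewrite /level_set /=.
  move=> <-; exists (p 1 0 / A) => //.
  by apply/cV2P; rewrite !mxE /=; split; field.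
by move=> [t _ <-]; rewrite !mxE /=; field.
Qed.

Lemma is_line_level_set (R : realType) (A B c : R) : A != 0 ->
  is_line (level_set A B c).
Proof.
move=> A0; exists (vec2 (c / A) 0), (vec2 (- B) A).
by rewrite level_set_line // vec2_eq0 (negPf A0) andbF.
Qed.

Lemma is_two_parallel_lines_level_sets (R : realType) (A B c d : R) :
  A != 0 -> c != d ->
  is_two_parallel_lines
    (level_set A B c `|` level_set A B d).
Proof.
move=> A0 cd; exists (level_set A B c), (level_set A B d); split=> //.
- exact: is_line_level_set.
- exact: is_line_level_set.
- exists (vec2 (c / A) 0), (vec2 (d / A) 0), (vec2 (- B) A).
  by rewrite !level_set_line // vec2_eq0 (negPf A0) andbF.
(* The base point of the first line separates the two: lying on the second line as well would force
   [c = d]. *)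
- move=> /seteqP [/(_ (vec2 (c / A) 0))]; rewrite /level_set /=.
  rewrite vec2E0 vec2E1 mulr0 addr0 mulrC divfK // => /(_ erefl) e _.
  by rewrite e eqxx in cd.
Qed.

Lemma conic_complete_square (R : realType) (A B C D E F : R) : A != 0 ->
  A * C = B ^+ 2 -> A * E = B * D ->
  conic A B C D E F =
    [set p : 'cV[R]_2 | (A * p 0 0 + B * p 1 0 + D) ^+ 2 = D ^+ 2 - A * F].
Proof.
move=> A0 hAC hAE; apply/seteqP; split=> p; rewrite /conic /=;
  set x := p 0 0; set y := p 1 0 => h.
  (* Modulo [hAC] and [hAE], the difference of the two sides is [A] times the polynomial of the
     conic; the converse inclusion cancels this [A]. *)
  apply/eqP; rewrite -subr_eq0.
  rewrite -[X in _ == X](mulr0 A) -[in X in _ == X]h; apply/eqP.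
  by ring: hAC hAE.
apply: (mulfI A0); rewrite mulr0; move/eqP: h; rewrite -subr_eq0 => /eqP h.
by rewrite -[RHS]h; ring: hAC hAE.
Qed.

Lemma det_conic_mx (R : realType) (A B C D E F : R) :
  \det (conic_mx A B C D E F) =
  A * (C * F - E ^+ 2) - B * (B * F - D * E) + D * (B * E - C * D).
Proof. by rewrite det_mx33 !mxE /=; ring. Qed.

Lemma principal_minor_conic_mx0 (R : realType) (A B C D E F : R) :
  principal_minor (conic_mx A B C D E F) 0 = C * F - E ^+ 2.
Proof. by rewrite /principal_minor det_mx22 !mxE /=; ring. Qed.

Lemma principal_minor_conic_mx1 (R : realType) (A B C D E F : R) :
  principal_minor (conic_mx A B C D E F) 1 = A * F - D ^+ 2.
Proof. by rewrite /principal_minor det_mx22 !mxE /=; ring. Qed.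

(** The completed square equals [D ^+ 2 - A * F], which has two opposite nonzero roots, no real
    root, or the single root 0, according to its sign. Each root [r] contributes the level set of
    value [r - D]. *)
Lemma conic_trichotomy (R : realType) (A B C D E F : R) : A != 0 ->
  A * C = B ^+ 2 -> A * E = B * D ->
  [/\ A * F - D ^+ 2 < 0 -> is_two_parallel_lines (conic A B C D E F),
      0 < A * F - D ^+ 2 -> conic A B C D E F = set0
    & A * F - D ^+ 2 = 0 -> is_line (conic A B C D E F)].
Proof.
move=> A0 hAC hAE; rewrite conic_complete_square //; split=> hM.
- have M_gt0 : 0 < D ^+ 2 - A * F by lra.
  set s := Num.sqrt (D ^+ 2 - A * F).
  have s_gt0 : 0 < s by rewrite sqrtr_gt0.
  rewrite -(sqr_sqrtr (ltW M_gt0)) -/s.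
  suff -> : [set p : 'cV[R]_2 | (A * p 0 0 + B * p 1 0 + D) ^+ 2 = s ^+ 2] =
      level_set A B (s - D) `|` level_set A B (- s - D).
    by apply: is_two_parallel_lines_level_sets => //; apply/eqP; lra.
  apply/seteqP; split=> p; rewrite /level_set /=.
    by move/eqP; rewrite eqf_sqr => /orP[] /eqP e; [left | right]; lra.
  by case=> ->; ring.
- by apply/seteqP; split=> p //= e;
    have := sqr_ge0 (A * p 0 0 + B * p 1 0 + D); lra.
- have -> : D ^+ 2 - A * F = 0 by lra.
  suff -> : [set p : 'cV[R]_2 | (A * p 0 0 + B * p 1 0 + D) ^+ 2 = 0] =
      level_set A B (- D) by apply: is_line_level_set.
  apply/seteqP; split=> p; rewrite /level_set /=;
    last by move=> ->; rewrite addNr expr0n.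
  by move/eqP; rewrite sqrf_eq0 addr_eq0 => /eqP.
Qed.

(** The second equation of the system is [B / A] times the first, so the centers form a single level
    set. *)
Lemma centers_line (R : realType) (A B C D E : R) : A != 0 ->
  A * C = B ^+ 2 -> A * E = B * D ->
  centers A B C D E = line (vec2 (- D / A) 0) (vec2 (- B) A).
Proof.
move=> A0 hAC hAE; rewrite -level_set_line //.
apply/seteqP; split=> p; rewrite /level_set /=; first by case.
move=> h; split=> //; apply: (mulfI A0).
transitivity (B * (A * p 0 0 + B * p 1 0)); first by ring: hAC.
by rewrite h; ring: hAE.
Qed.

Theorem mainTheorem3 (R : realType) (A B C D E F : R)
    (hA : A != 0) (hB : B != 0) (hC : C != 0)
    (hdep : ~~ free [:: vec2 A B; vec2 B C])
    (hspan : vec2 (- D) (- E) \in <[vec2 A B]>%VS) :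
  let K := conic A B C D E F in
  let M := conic_mx A B C D E F in
  let M11 := principal_minor M 0 in
  let M22 := principal_minor M 1 in
  [/\ A * C - B ^+ 2 = 0,
      <[vec2 A B]>%VS = <[vec2 B C]>%VS,
      B * D - A * E = 0
    & C * D - B * E = 0] /\
  infinite_set (centers A B C D E) /\
  \det M = 0 /\
  M22 = A * F - D ^+ 2 /\
  M11 = C * F - E ^+ 2 /\
  [/\ M22 < 0 -> is_two_parallel_lines K,
      0 < M22 -> K = set0
    & M22 = 0 -> is_line K] /\
  [/\ M11 < 0 -> is_two_parallel_lines K,
      0 < M11 -> K = set0
    & M11 = 0 -> is_line K].
Proof.
move=> K M M11 M22.
have BC0 : vec2 B C != 0 by rewrite vec2_eq0 (negPf hB).
(* As [vec2 B C] is nonzero, dependence of the pair puts [vec2 A B] on the line that it spans. *)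
have [k /cV2P] : exists k, vec2 A B = k *: vec2 B C.
  apply/vlineP; move: hdep; rewrite free_cons seq1_free BC0 andbT negbK.
  by rewrite span_seq1.
rewrite !mxE /= => -[Ak Bk].
have k0 : k != 0 by apply: contraNneq hA => k0; rewrite Ak k0 mul0r.
have [l /cV2P] := vlineP _ _ hspan.
rewrite !mxE /= => -[Dl El].
have hAC : A * C = B ^+ 2 by rewrite Ak expr2 {2}Bk; ring.
(* Since [- D = l * A] and [- E = l * B], both sides equal [- (l * A * B)]. *)
have hAE : A * E = B * D.
  by apply: oppr_inj; rewrite -!mulrN Dl El; ring.
have hCD : C * D = B * E.
  by apply: oppr_inj; rewrite -!mulrN Dl El; ring: hAC.
have M22E : M22 = A * F - D ^+ 2 by rewrite /M22 principal_minor_conic_mx1.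
have M11E : M11 = C * F - E ^+ 2 by rewrite /M11 principal_minor_conic_mx0.
have M11M22 : M11 = (B / A) ^+ 2 * M22.
  apply: (mulfI (expf_neq0 2 hA)); rewrite M11E M22E.
  transitivity (A * (A * C) * F - (A * E) ^+ 2); first by ring.
  by rewrite hAC hAE; field.
(* Strict positivity, from [B != 0], lets the sign conditions pass between [M11] and [M22]. *)
have BA_gt0 : 0 < (B / A) ^+ 2.
  by rewrite exprn_even_gt0 //= mulf_neq0 ?invr_eq0.
have tri := conic_trichotomy F hA hAC hAE; rewrite -M22E in tri.
split; first split.
- by rewrite hAC subrr.
- have -> : vec2 A B = k *: vec2 B C by apply/cV2P; rewrite !mxE.
  apply/eqP; rewrite eqEsubv -!memvE memvZ ?memv_line //=.
  (* The reverse inclusion of spans inverts the scalar [k], nonzero because [A] is. *)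
  by apply/vlineP; exists k^-1; rewrite scalerA mulVf ?scale1r.
- by rewrite hAE subrr.
- by rewrite hCD subrr.
split.
  rewrite centers_line //; apply: infinite_line.
  by rewrite vec2_eq0 (negPf hA) andbF.
split; first rewrite /M det_conic_mx.
  (* This is the cofactor expansion along the last row, in which each of the three minors
     vanishes. *)
  transitivity (F * (A * C - B ^+ 2) - E * (A * E - B * D)
                + D * (B * E - C * D)).
    by ring.
  by rewrite hAC hAE hCD !subrr; ring.
do 3!split=> //.
by rewrite M11M22 pmulr_rlt0 // pmulr_rgt0 //; case: tri => lt0 gt0 eq0;
  split=> // /eqP; rewrite mulf_eq0 gt_eqF //= => /eqP.
Qed.
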